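(* Let $r\ge 0$, let $a_1,\dots,a_{r+1}\in\mathbb{N}_0$ and let $c_1,\dots,c_r$ be integers with $c_j\ge 2$ for all $j$. Set $\mathbf{s}=(\{2\}^{a_1},c_1,\dots,\{2\}^{a_r},c_r,\{2\}^{a_{r+1}})$, assumed non-empty (i.e. $a_1\ge 1$ if $r=0$), and $\tilde{\mathbf{s}}=(2a_1,c_1,\dots,2a_r,c_r,2a_{r+1})$. Then $$\zeta^\star(\mathbf{s})=-2\sum_{I\subseteq[r]}\ \sum_{\substack{i_t+j_t+|\mathbf{x}_t|=c_t,\\ i_t\ge 1,\ j_t\ge 2\ \ \forall t\notin I}}2^{|\overline{I}|+\sum_{t\notin I}l(\mathbf{x}_t)}\ \zeta\big(\nu(\kappa_I(\tilde{\mathbf{s}}))\big).$$ Here, for each $I\subseteq[r]$, the second sum runs over all choices, for every $t\in[r]\setminus I$, of integers $i_t\ge 1$, $j_t\ge 2$ and of a (possibly empty) finite sequence $\mathbf{x}_t$ of positive integers with $i_t+j_t+|\mathbf{x}_t|=c_t$.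
   Context: $\mathbb{N}_0$ is the set of non-negative integers, $\mathbb{Z}^*$ the set of nonzero integers, and $[r]=\{1,\dots,r\}$ (so $[0]=\emptyset$). For $\mathbf{s}=(s_1,\dots,s_m)\in(\mathbb{Z}^* )^m$ and $n\ge 1$ put $$H_n(\mathbf{s})=\sum_{n\ge k_1>\cdots>k_m\ge 1}\prod_{i=1}^m\frac{\operatorname{sgn}(s_i)^{k_i}}{k_i^{|s_i|}},\qquad H_n^\star(\mathbf{s})=\sum_{n\ge k_1\ge\cdots\ge k_m\ge 1}\prod_{i=1}^m\frac{\operatorname{sgn}(s_i)^{k_i}}{k_i^{|s_i|}},$$ and $\zeta(\mathbf{s})=\lim_{n\to\infty}H_n(\mathbf{s})$, $\zeta^\star(\mathbf{s})=\lim_{n\to\infty}H^\star_n(\mathbf{s})$. $\{2\}^a$ denotes the string of $a$ entries equal to $2$ (empty if $a=0$). For a finite sequence $\mathbf{x}=(x_1,\dots,x_m)$ of positive integers, $l(\mathbf{x})=m$ and $|\mathbf{x}|=x_1+\cdots+x_m$ (both $0$ if $\mathbf{x}=\emptyset$). For $I\subseteq[r]$ put $\overline{I}=[r]\setminus I$, and let $|\overline{I}|$ be its cardinality. The operation $\kappa_I=\sigma_{\overline I}\circ\mu_I$ acts on $\tilde{\mathbf{s}}=(2a_1,c_1,2a_2,\dots,2a_r,c_r,2a_{r+1})$, viewed as a string of symbols, as follows: for each $t\in I$ (merge $\mu_t$), the symbols ''$,c_t,$'' between $2a_t$ and $2a_{t+1}$ are replaced by ''$+c_t+$''; for each $t\in\overline{I}$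 (substitution $\sigma_t$), the symbols ''$,c_t,$'' are replaced by ''$+j_t,\mathbf{x}_t,i_t+$'', where $i_t,j_t$ are integers and $\mathbf{x}_t$ is a finite (possibly empty) sequence of positive integers whose entries are inserted as separate components (if $\mathbf{x}_t=\emptyset$ the replacement is ''$+j_t,i_t+$''). For example, for $r=2$, $\kappa_{\{1,2\}}(\tilde{\mathbf{s}})=(2a_1+c_1+2a_2+c_2+2a_3)$, $\kappa_{\{1\}}(\tilde{\mathbf{s}})=(2a_1+c_1+2a_2+j_2,\mathbf{x}_2,i_2+2a_3)$, $\kappa_{\{2\}}(\tilde{\mathbf{s}})=(2a_1+j_1,\mathbf{x}_1,i_1+2a_2+c_2+2a_3)$, $\kappa_\emptyset(\tilde{\mathbf{s}})=(2a_1+j_1,\mathbf{x}_1,i_1+2a_2+j_2,\mathbf{x}_2,i_2+2a_3)$. For a sequence $(e_1,\dots,e_m)$ of positive integers with $m\ge 1$, the negation operator is $\nu(e_1,\dots,e_m)=(-e_1,e_2,\dots,e_m)$. *)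

(* Defs.v *)
From HB Require Import structures.
From mathcomp Require Import all_boot all_order all_algebra.
From mathcomp Require Import all_classical all_reals all_analysis.

Set Implicit Arguments.
Unset Strict Implicit.
Unset Printing Implicit Defensive.

Import Order.TTheory GRing.Theory Num.Theory.
Import numFieldNormedType.Exports.

Local Open Scope ring_scope.

(* The factor sgn(e)^k / k^|e| attached to an exponent e : int; it is the
   intended one for e <> 0 and k > 0. *)
Definition mzv_factor (R : realType) (e : int) (k : nat) : R :=
  (sgz e)%:~R ^+ k / k%:R ^+ `|e|%N.

(* The indices k_1, ..., k_m range over 'I_n.+1 = {0, ..., n}; the value 0 is
   excluded by the condition. *)
Definition H (R : realType) (s : seq int) (n : nat) : R :=
  \sum_(k : (size s).-tuple 'I_n.+1 |
          sorted gtn [seq val h | h <- k] && all (fun h => (0 < val h)%N) k)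
    \prod_(i < size s) mzv_factor R s`_i (tnth k i).

Definition Hstar (R : realType) (s : seq int) (n : nat) : R :=
  \sum_(k : (size s).-tuple 'I_n.+1 |
          sorted geq [seq val h | h <- k] && all (fun h => (0 < val h)%N) k)
    \prod_(i < size s) mzv_factor R s`_i (tnth k i).

Definition zeta (R : realType) (s : seq int) : R := limn (H R s).

Definition zetastar (R : realType) (s : seq int) : R := limn (Hstar R s).

(* Index conventions: a : 'I_r.+1 -> nat and c : 'I_r -> nat are 0-based, so for
   t : 'I_r the entry c t lies between a (widen_ord _ t) and a (lift ord0 t),
   lift ord0 t being t + 1. *)

(* ({2}^a_1, c_1, {2}^a_2, ..., c_r, {2}^a_{r+1}) *)
Definition string_s (r : nat) (a : 'I_r.+1 -> nat) (c : 'I_r -> nat) : seq nat :=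
  nseq (a ord0) 2%N ++
  flatten [seq c t :: nseq (a (lift ord0 t)) 2%N | t <- enum 'I_r].

(* glue u v is the string "u + v": the last entry of u and the first entry of v
   are joined by the symbol "+" and become one entry, so that
   (u_1, ..., u_p) + (v_1, ..., v_q) = (u_1, ..., u_p + v_1, ..., v_q). *)
Fixpoint glue (u v : seq nat) : seq nat :=
  match u, v with
  | [::], _ => v
  | [:: x], y :: v' => (x + y)%N :: v'
  | x :: u', _ => x :: glue u' v
  end.

(* A choice, for every t outside I, of a triple (j_t, x_t, i_t), in the order in
   which the three items occur in the substituted string. *)
Notation choices I :=
  {ffun {t | t \notin I} -> nat * seq nat * nat}.

Definition admissible (r : nat) (c : 'I_r -> nat) (I : {set 'I_r}) :
    set (choices I) :=
  [set p : choices I | forall t : {t | t \notin I},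
     let: (j, x, i) := p t in
     [/\ (i + j + sumn x)%N = c (val t), (1 <= i)%N, (2 <= j)%N
       & all (leq 1) x]].

Definition total_length (r : nat) (I : {set 'I_r}) (p : choices I) : nat :=
  \sum_(t : {t | t \notin I}) size (p t).1.2.

(* What stands between the two outer "+" signs in the replacement of ",c_t,":
   c_t for t in I (merge), and j_t, x_t, i_t for t outside I (substitution).
   insub t is None exactly when t belongs to I. *)
Definition block (r : nat) (c : 'I_r -> nat) (I : {set 'I_r}) (p : choices I)
    (t : 'I_r) : seq nat :=
  if insub t is Some u then let: (j, x, i) := p u in j :: rcons x i
  else [:: c t].

(* The string 2a_1 + block_1 + 2a_2 + ... + block_r + 2a_{r+1}. *)
Definition kappa (r : nat) (a : 'I_r.+1 -> nat) (c : 'I_r -> nat)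
    (I : {set 'I_r}) (p : choices I) : seq nat :=
  foldl (fun u t => glue (glue u (block c p t)) [:: (2 * a (lift ord0 t))%N])
    [:: (2 * a ord0)%N] (enum 'I_r).

Definition nu (e : seq nat) : seq int :=
  if e is e1 :: e' then - e1%:Z :: [seq x%:Z | x <- e'] else [::].

(* Sums over admissible choices are finite sums. *)
Lemma finite_admissible (r : nat) (c : 'I_r -> nat) (I : {set 'I_r}) :
  finite_set (@admissible r c I).
Proof.
pose N := (\sum_t c t)%N.
pose F (q : {ffun {t | t \notin I} -> 'I_N.+1 * (N.-bseq 'I_N.+1) * 'I_N.+1}) :
  choices I :=
  [ffun t => (val (q t).1.1, [seq val h | h <- (q t).1.2], val (q t).2)].
apply: (@sub_finite_set _ _ (F @` setT)%classic); last first.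
  by apply: finite_image; exact: finite_finset.
move=> p pA.
pose q : {ffun {t | t \notin I} -> 'I_N.+1 * (N.-bseq 'I_N.+1) * 'I_N.+1} :=
  [ffun t => (inord (p t).1.1,
    insub_bseq N [seq (inord h : 'I_N.+1) | h <- (p t).1.2], inord (p t).2)].
exists q => //; apply/ffunP => t; rewrite !ffunE /=.
move: (pA t); case: (p t) => [[j x] i] /= [cE i1 j2 x1].
have cN : (c (val t) <= N)%N by rewrite /N (bigD1 (val t)) //= leq_addr.
have xle y : y \in x -> (y <= sumn x)%N.
  elim: x {cE x1} => // z x IH; rewrite inE /= => /orP[/eqP ->|/IH h].
    exact: leq_addr.
  by rewrite (leq_trans h) // leq_addl.
have sx : (size x <= sumn x)%N.
  elim: x x1 {cE xle} => //= z x IH /andP[z1 /IH h].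
  by rewrite -add1n leq_add.
have xN : (sumn x <= N)%N by rewrite (leq_trans _ cN) // -cE leq_addl.
have iN : (i <= N)%N by rewrite (leq_trans _ cN) // -cE -addnA leq_addr.
have jN : (j <= N)%N.
  by rewrite (leq_trans _ cN) // -cE addnAC leq_addl.
rewrite !inordK ?ltnS // /insub_bseq insubdK.
  rewrite -map_comp; congr (_, _, _).
  rewrite -[RHS]map_id; apply/eq_in_map => y /xle yx /=.
  by rewrite inordK // ltnS (leq_trans yx).
by rewrite unfold_in /= size_map (leq_trans sx).
Qed.

(* Main.v *)
Require Import Defs.
From mathcomp Require Import all_boot all_order all_algebra.
From mathcomp Require Import all_classical all_reals all_analysis.
From mathcomp Require Import ring lra.
Import Order.TTheory GRing.Theory Num.Theory.
Import numFieldNormedType.Exports.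
Local Open Scope ring_scope.

(** With w_n(k) = 'C(n,k) / 'C(n+k,k), the transform f |-> sum_(k <= n) w_n(k)
    (-1)^k f(k) turns the two steps that build a star sum into operations on f:
    prepending the exponent 2 to s becomes division of f by k^2, and dividing
    the transform by n becomes f |-> f/k + 2 sum_(l < k) f(l)/l.  Starting from
    H*_n(empty) = 1 = -2 sum_k w_n(k) (-1)^k, this writes H*_n(s) as -2 times
    the transform of an explicit f.  Expanding the powers of 1/k + 2 sum/l
    yields the sum over merges (never picking the inner sum) and substitutions
    (picking it at least once); each term of the expansion is a nested sum.
    Finally w_n(k) increases to 1, and the nested sums are O(k^(-3/2)), so each
    term of the finite identity converges by dominated convergence. *)

(* This is 'C(n, k) / 'C(n + k, k), written so that it vanishes for k > n. *)
Definition bweight (R : realType) (n k : nat) : R :=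
  \prod_(j < k) ((n%:R - j%:R) / (n%:R + j.+1%:R)).

Definition wsum {R : realType} (n : nat) (f : nat -> R) : R :=
  \sum_(1 <= k < n.+1) bweight R n k * (-1) ^+ k * f k.

Definition mulpow {R : realType} (x : nat) (f : nat -> R) (k : nat) : R :=
  f k / k%:R ^+ x.

Definition psum {R : realType} (f : nat -> R) (k : nat) : R :=
  \sum_(1 <= l < k) f l.

Definition recip_op {R : realType} (f : nat -> R) (k : nat) : R :=
  mulpow 1 f k + 2 * psum (mulpow 1 f) k.

Fixpoint starsum (R : realType) (s : seq nat) (n : nat) : R :=
  if s is x :: s' then psum (mulpow x (starsum R s')) n.+1 else 1.

(* H*_n(s) is - 2 times the transform wsum n of this function. *)
Fixpoint starfun (R : realType) (s : seq nat) : nat -> R :=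
  if s is x :: s' then mulpow 2 (iter (x - 2) recip_op (starfun R s'))
  else fun=> 1.

(** * The weights: recurrences and bounds *)

Lemma bweightS (R : realType) n k :
  bweight R n k.+1 = bweight R n k * ((n%:R - k%:R) / (n%:R + k.+1%:R)).
Proof. by rewrite /bweight big_ord_recr. Qed.

Lemma bweight0 (R : realType) n : bweight R n 0 = 1.
Proof. by rewrite /bweight big_ord0. Qed.

Lemma bweight_small (R : realType) n k : (n < k)%N -> bweight R n k = 0.
Proof.
by move=> nk; rewrite /bweight (bigD1 (Ordinal nk)) //= subrr mul0r mul0r.
Qed.

(** For k <= n, w_n(k) = n!^2 / ((n - k)! (n + k)!), so w_n(k) / w_(n+1)(k) = (n + 1 - k)(n + 1 + k)
    / (n + 1)^2; for larger k both sides vanish. *)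
Lemma bweight_pred (R : realType) n k :
  n.+1%:R ^+ 2 * bweight R n k = (n.+1%:R ^+ 2 - k%:R ^+ 2) * bweight R n.+1 k.
Proof.
elim: k => [|k IH]; first by rewrite !bweight0; ring.
rewrite !bweightS mulrA IH -!natr1.
have n0 : 0 <= n%:R :> R by []. have k0 : 0 <= k%:R :> R by [].
by field; apply/andP; split; lra.
Qed.

Lemma bweight_ge0 (R : realType) n k : 0 <= bweight R n k.
Proof.
have [nk|kn] := ltnP n k; first by rewrite bweight_small.
apply: prodr_ge0 => -[j jk] _ /=; apply: divr_ge0; last exact: addr_ge0.
by rewrite subr_ge0 ler_nat (leq_trans _ kn) // ltnW.
Qed.

(** With N = n + 1, passing from k to k + 1 multiplies the weight by 1 - (2k + 1) / (N + k + 1). The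
    defect thus grows by at most (2k + 1) / N, and the first k odd numbers add up to k^2. *)
Lemma bweight_bounds (R : realType) n k :
  bweight R n.+1 k <= 1 /\ 1 - bweight R n.+1 k <= k%:R ^+ 2 / n.+1%:R.
Proof.
elim: k => [|k [IH1 IH2]]; first by rewrite bweight0; rewrite subrr expr0n mul0r.
have w0 := bweight_ge0 R n.+1 k.
have n0 : 0 < n.+1%:R :> R by rewrite ltr0n. have k0 : 0 <= k%:R :> R by [].
have -> : bweight R n.+1 k.+1 =
    bweight R n.+1 k - bweight R n.+1 k * ((2 * k%:R + 1) / (n.+1%:R + k.+1%:R)).
  by rewrite bweightS -(natr1 k); field; lra.
have q0 : 0 <= (2 * k%:R + 1) / (n.+1%:R + k.+1%:R) :> R.
  by apply: divr_ge0; apply: addr_ge0 => //; exact: mulr_ge0.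
have q1 : (2 * k%:R + 1) / (n.+1%:R + k.+1%:R) <= (2 * k%:R + 1) / n.+1%:R :> R.
  apply: ler_wpM2l; first by apply: addr_ge0 => //; exact: mulr_ge0.
  by rewrite lef_pV2 ?posrE ?addr_gt0 ?ltr0n // lerDl.
split; first by nra.
have -> : k.+1%:R ^+ 2 / n.+1%:R
  = k%:R ^+ 2 / n.+1%:R + (2 * k%:R + 1) / n.+1%:R :> R.
  by rewrite -(natr1 k); field; lra.
move: q0 q1; set q := (_ / (_ + _)) => q0 q1.
have : bweight R n.+1 k * q <= q by rewrite ler_piMl.
move: (bweight R n.+1 k * q) (bweight R n.+1 k) IH1 IH2 w0 => x y.
move: (_ ^+ 2 / _) (_ / n.+1%:R) q1 => u v; clearbody q; lra.
Qed.

(** * The transform and the finite identity for star sums *)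

(** Termwise, [bweight_pred] reads w_n(k) / k^2 = w_(n+1)(k) / k^2 - w_(n+1)(k) / (n + 1)^2. *)
Lemma wsum_mulpow2 {R : realType} (f : nat -> R) n :
  wsum n.+1 (mulpow 2 f) = wsum n (mulpow 2 f) + wsum n.+1 f / n.+1%:R ^+ 2.
Proof.
(* The range may be extended to n + 1 because w_n(n + 1) = 0. *)
have -> : wsum n (mulpow 2 f) =
    \sum_(1 <= k < n.+2) bweight R n k * (-1) ^+ k * mulpow 2 f k.
  by rewrite [RHS]big_nat_recr //= bweight_small // !mul0r addr0.
rewrite /wsum mulr_suml -big_split /=; apply: eq_big_nat => k /andP[k1 _].
have n0 : n.+1%:R != 0 :> R by rewrite pnatr_eq0.
have k0 : k%:R != 0 :> R by rewrite pnatr_eq0 -lt0n.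
have -> : bweight R n k = (n.+1%:R ^+ 2 - k%:R ^+ 2) * bweight R n.+1 k / n.+1%:R ^+ 2.
  by rewrite -bweight_pred; field.
by rewrite /mulpow; field; rewrite nat1r n0.
Qed.

(** After exchanging the sums, f(l) has coefficient (-1)^l w_n(l) / l plus 2 / l times the
    alternating tail over k > l; since 1/l - (n - l) / (n l) = 1/n, this is (-1)^l w_n(l) / n. *)
Lemma wsum_recip_op {R : realType} (f : nat -> R) n : (0 < n)%N ->
  wsum n (recip_op f) = wsum n f / n%:R.
Proof.
move=> n0; have n0' : n%:R != 0 :> R by rewrite pnatr_eq0 -lt0n.
apply/eqP; rewrite -subr_eq0 mulr_suml -sumrB; apply/eqP.
(* The factor (-1)^m w_n(m) (n - m) / n is -2 sum_(k > m) (-1)^k w_n(k). *)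
suff /(_ n) -> : forall m,
    \sum_(1 <= k < m.+1) (bweight R n k * (-1) ^+ k * recip_op f k
                          - bweight R n k * (-1) ^+ k * f k / n%:R)
    = (-1) ^+ m * bweight R n m * ((n%:R - m%:R) / n%:R) * psum (mulpow 1 f) m.+1.
  by rewrite subrr mul0r mulr0 mul0r.
elim=> [|m IH]; first by rewrite /psum !big_geq // mulr0.
rewrite big_nat_recr //= IH /recip_op /psum [in RHS]big_nat_recr //=.
rewrite bweightS exprS /mulpow expr1 -!(natr1 m).
have m0 : 0 <= m%:R :> R by []. have n1 : 0 < n%:R :> R by rewrite ltr0n.
by field; apply/and3P; split; lra.
Qed.

Lemma wsum_one (R : realType) n : (0 < n)%N -> wsum n (fun=> 1 : R) = - 2^-1.
Proof.
move=> n0; have n1 : 0 < n%:R :> R by rewrite ltr0n.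
(* The correction term is 1/2 at m = 0 and vanishes at m = n. *)
suff /(_ n) H : forall m, \sum_(1 <= k < m.+1) bweight R n k * (-1) ^+ k * 1
    = - 2^-1 + (-1) ^+ m * bweight R n m * ((n%:R - m%:R) / (2 * n%:R)).
  by rewrite /wsum H subrr mul0r mulr0 addr0.
elim=> [|m IH]; first by rewrite big_geq // bweight0 subr0; field; lra.
rewrite big_nat_recr //= IH bweightS exprS -!(natr1 m).
have m0 : 0 <= m%:R :> R by [].
by field; apply/andP; split; lra.
Qed.

(** Of the c factors 1/n brought by an exponent c, two come from the increment in [wsum_mulpow2] and
    c - 2 from the iterates of [recip_op]. *)
Lemma starsum_wsum (R : realType) (s : seq nat) n :
  all (leq 2) s -> (0 < n)%N -> starsum R s n = - 2 * wsum n (starfun R s).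
Proof.
elim: s n => [|c s IH] n /=.
  by move=> _ n0; rewrite wsum_one //; field.
(* For a non-empty string both sides are empty sums at n = 0, so the inner induction can start
   there. *)
move=> /andP[c2 s2] _; elim: n => [|n IHn].
  by rewrite /wsum /psum !big_geq // mulr0.
rewrite /psum big_nat_recr //= -/(psum _ _) IHn /mulpow IH // -/(mulpow _ _).
rewrite (wsum_mulpow2 _ n) mulrDr; congr (_ + _).
rewrite -mulrA; congr (_ * _).
have -> : wsum n.+1 (iter (c - 2) recip_op (starfun R s))
    = wsum n.+1 (starfun R s) / n.+1%:R ^+ (c - 2).
  elim: (c - 2)%N => [|m IHm]; first by rewrite expr0 divr1.
  by rewrite iterS wsum_recip_op // IHm exprSr invfM mulrA.
by rewrite -mulrA -invfM -exprD subnK.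
Qed.

(** * Words as operators *)

(* For u nonempty, wordop u (fun=> 1) is 2 ^ (length u - 1) times the summand over
   k_1 = k of the nested sum with exponents u; gluing words composes the
   operators. *)
Fixpoint wordop (R : realType) (u : seq nat) (f : nat -> R) : nat -> R :=
  match u with
  | [::] => f
  | [:: x] => mulpow x f
  | x :: u' => mulpow x (fun k => 2 * psum (wordop R u' f) k)
  end.
Arguments wordop {R}.

Lemma mulpowD {R : realType} (f : nat -> R) x y :
  mulpow (x + y) f = mulpow x (mulpow y f).
Proof.
by apply/funext => k; rewrite /mulpow exprD invfM mulrA mulrAC.
Qed.

Lemma psum_sum {R : realType} (I : Type) (r : seq I) (f : I -> nat -> R) k :
  psum (fun l => \sum_(i <- r) f i l) k = \sum_(i <- r) psum (f i) k.
Proof. by rewrite /psum exchange_big. Qed.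

Lemma mulpow_sum {R : realType} (I : Type) (r : seq I) (f : I -> nat -> R) x k :
  mulpow x (fun l => \sum_(i <- r) f i l) k = \sum_(i <- r) mulpow x (f i) k.
Proof. by rewrite /mulpow mulr_suml. Qed.

Lemma wordop_sum {R : realType} (I : Type) (r : seq I) (f : I -> nat -> R) u k :
  wordop u (fun l => \sum_(i <- r) f i l) k = \sum_(i <- r) wordop u (f i) k.
Proof.
elim: u k => [|x [|y u] IH] k //=; first exact: mulpow_sum.
rewrite -mulpow_sum; congr (mulpow _ _ _); apply/funext => l.
rewrite -mulr_sumr -psum_sum; congr (_ * psum _ _).
by apply/funext => m; rewrite -IH.
Qed.

(** At the junction, the last exponent of u meets the first of v with no sum in between, and
    [mulpowD] adds them. *)
Lemma wordop_glue {R : realType} (f : nat -> R) u v :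
  wordop (Defs.glue u v) f = wordop u (wordop v f).
Proof.
elim: u => [|x [|y u] IH] //; first clear IH.
  by case: v => [|z [|t v]] //=; rewrite mulpowD.
have wordop_cons w g : w != [::] ->
    wordop (x :: w) g = mulpow x (fun k => 2 * psum (wordop w g) k) by case: w.
rewrite -[Defs.glue _ _]/(x :: Defs.glue (y :: u) v) !wordop_cons ?IH //.
by case: u {IH} => //; case: v.
Qed.

(** * Compositions and the expansion of iterated [recip_op] *)

Definition incr_head (u : seq nat) : seq nat :=
  if u is x :: u' then x.+1 :: u' else [::].

(** The compositions of m + 1, generated so that the two cases match the two summands of
    [recip_op]. *)
Fixpoint comps (m : nat) : seq (seq nat) :=
  if m is m'.+1 then map (cons 1%N) (comps m') ++ map incr_head (comps m')
  else [:: [:: 1%N]].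

Lemma compsS m :
  comps m.+1 = map (cons 1%N) (comps m) ++ map incr_head (comps m).
Proof. by []. Qed.

Lemma mem_comps m u :
  (u \in comps m) = [&& u != [::], all (leq 1) u & sumn u == m.+1].
Proof.
elim: m u => [|m IH] u.
  rewrite inE; apply/eqP/idP => [-> //|].
  case: u => [|[|x] [|[|y] u]] //=.
  - by rewrite addn0 => /eqP ->.
  - by move=> /andP[_]; rewrite addSn addnS.
rewrite mem_cat; apply/orP/idP.
  case=> /mapP[v]; rewrite IH => /and3P[v0 v1 /eqP vm] ->.
    by rewrite /= v1 vm add1n eqxx.
  by case: v v0 v1 vm => //= x v _ /andP[_ ->]; rewrite addSn => ->; rewrite eqxx.
case: u => [|[|[|x]] u] //= /andP[u1 /eqP um].
  left; apply: map_f; move: um; rewrite IH u1 add1n => -[um]; rewrite um.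
  by rewrite eqxx andbT; case: (u) (um).
right; apply/mapP; exists (x.+1 :: u) => //; rewrite IH /= u1 /=.
by move: um; rewrite !addSn => -[->]; rewrite eqxx.
Qed.

Lemma uniq_comps m : uniq (comps m).
Proof.
elim: m => //= m IH; rewrite cat_uniq map_inj_uniq ?IH => [|u v []] //=.
rewrite map_inj_in_uniq ?IH ?andbT => [|[|x u] [|y v]]; rewrite ?mem_comps //=.
  apply/hasPn => u /mapP[[|x v]]; rewrite mem_comps //= => /andP[/andP[x0 _] _] ->.
  by apply/mapP => -[w _ []] xE; rewrite xE in x0.
by move=> _ _ [-> ->].
Qed.

(** In one more [recip_op], the term f/k raises the head of the word, while the inner sum makes the
    outer division by k a new first part 1, its factor 2 being the one in [wordop]. *)
Lemma sum_wordop_comps {R : realType} (f : nat -> R) m k :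
  \sum_(u <- comps m) wordop u f k = mulpow 1 (iter m recip_op f) k.
Proof.
elim: m k => [|m IH] k; first by rewrite big_seq1.
have E : mulpow 1 (iter m recip_op f) = fun k => \sum_(u <- comps m) wordop u f k.
  by apply/funext => l; rewrite IH.
rewrite compsS big_cat !big_map iterS [RHS]/mulpow /recip_op E psum_sum mulrDl addrC.
congr (_ + _).
  rewrite mulr_sumr mulr_suml big_seq [RHS]big_seq.
  by apply: eq_bigr => u; rewrite mem_comps => /andP[]; case: u.
rewrite mulr_suml big_seq [RHS]big_seq.
apply: eq_bigr => u; rewrite mem_comps => /andP[].
by case: u => // x [|y u] _ _ /=; rewrite /mulpow exprS invfM mulrCA mulrC.
Qed.

(* The compositions of c with head at least 2: the one-part composition is the
   merge, and the others are the substitutions j, x, i. *)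
Definition blocks (c : nat) : seq (seq nat) := map incr_head (comps (c - 2)).

Lemma mem_blocks c u : (2 <= c)%N ->
  (u \in blocks c) = [&& (2 <= head 0%N u)%N, all (leq 1) u & sumn u == c].
Proof.
case: c => [|[|c]] // _; rewrite /blocks subSS subSS subn0.
apply/mapP/idP => [[[|x v]]|].
- by rewrite mem_comps.
- rewrite mem_comps /= => /andP[/andP[x0 v1] /eqP xv] -> /=.
  by rewrite ltnS x0 v1 addSn xv eqxx.
case: u => [|[|[|x]] u] //= /andP[u1 /eqP um].
exists (x.+1 :: u) => //; rewrite mem_comps /= u1.
by move: um; rewrite !addSn => -[->]; rewrite eqxx.
Qed.

Lemma uniq_blocks c : uniq (blocks c).
Proof.
rewrite map_inj_in_uniq ?uniq_comps // => -[|x u] [|y v];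
  rewrite ?mem_comps //=.
by move=> _ _ [-> ->].
Qed.

(** One division by k in [mulpow 2] is used by [sum_wordop_comps]; the other raises every head,
    whence the condition j >= 2. *)
Lemma sum_wordop_blocks {R : realType} (f : nat -> R) c k :
  \sum_(u <- blocks c) wordop u f k = mulpow 2 (iter (c - 2) recip_op f) k.
Proof.
rewrite big_map (mulpowD _ 1 1) /mulpow -/(mulpow 1 _ _) -sum_wordop_comps.
rewrite mulr_suml big_seq [RHS]big_seq; apply: eq_bigr => u.
by rewrite mem_comps => /andP[]; case: u => // x [|y u] _ _ /=;
  rewrite /mulpow exprS invfM mulrA mulrAC.
Qed.

(** * Lists of blocks and the expansion of [starfun] *)

Fixpoint block_lists (cs : seq nat) : seq (seq (seq nat)) :=
  if cs is c :: cs' then [seq u :: bs | u <- blocks c, bs <- block_lists cs']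
  else [:: [::]].

(** The string of [kappa] with the blocks as data, free of any reference to I. *)
Definition interleave (a0 : nat) (l : seq (seq nat * nat)) : seq nat :=
  foldl (fun u x => Defs.glue (Defs.glue u x.1) [:: (2 * x.2)%N]) [:: (2 * a0)%N] l.

Lemma starfun_nseq2 (R : realType) a s :
  starfun R (nseq a 2%N ++ s) = mulpow (2 * a) (starfun R s).
Proof.
elim: a => [|a IH] /=.
  by apply/funext => k; rewrite /mulpow muln0 expr0 divr1.
by rewrite IH mulnS mulpowD.
Qed.

Lemma sum_wordop_interleave (R : realType) a0 cs (l : seq nat) k :
  size cs = size l ->
  \sum_(bs <- block_lists cs) wordop (interleave a0 (zip bs l)) (fun=> 1 : R) k
  = starfun R (nseq a0 2%N ++
               flatten [seq x.1 :: nseq x.2 2%N | x <- zip cs l]) k.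
Proof.
move=> szl; rewrite starfun_nseq2.
(* [tl m] composes the operators of the pairs still to be glued; by linearity the sum over each
   block is then taken inside, one block at a time. *)
pose tl (m : seq (seq nat * nat)) : nat -> R :=
  foldr (fun x f => wordop x.1 (mulpow (2 * x.2) f)) (fun=> 1) m.
have foldE m u :
  wordop (foldl (fun u x => Defs.glue (Defs.glue u x.1) [:: (2 * x.2)%N]) u m)
    (fun=> 1) = wordop u (tl m).
  by elim: m u => //= x m IH u; rewrite IH !wordop_glue.
under eq_bigr do rewrite /interleave foldE /=.
rewrite -mulpow_sum; congr (mulpow _ _ _); apply/funext => {}k.
elim: cs l szl k => [|c cs IH] [|b l] //= szl k; first by rewrite big_seq1.
rewrite big_allpairs_dep /= starfun_nseq2 -sum_wordop_blocks.
apply: eq_bigr => u _; rewrite -wordop_sum; congr (wordop _ _ _); apply/funext => m.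
rewrite -mulpow_sum; congr (mulpow _ _ _); apply/funext => {}m.
by rewrite IH //; case: szl.
Qed.

Lemma uniq_block_lists cs : uniq (block_lists cs).
Proof.
elim: cs => //= c cs IH; apply: allpairs_uniq => //; first exact: uniq_blocks.
by move=> [u v] [u' v'] _ _ /= [-> ->].
Qed.

Lemma mem_block_lists cs bs :
  (bs \in block_lists cs)
  = (size bs == size cs) && all (fun x => x.1 \in blocks x.2) (zip bs cs).
Proof.
elim: cs bs => [|c cs IH] [|b bs] //=.
  by apply/allpairsP => -[[u v] [_ _]].
rewrite eqSS andbCA -IH; apply/allpairsP/andP.
  by move=> [[u v] [/= ub vb [-> ->]]].
by move=> [ub vb]; exists (b, bs).
Qed.

(** * Harmonic sums over tuples as iterated sums *)

Lemma sum_ord_nat (V : nmodType) (F : nat -> V) m N : (m <= N)%N ->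
  \sum_(h < N | (h < m)%N && (0 < h)%N) F h = \sum_(1 <= h < m) F h.
Proof.
move=> mN; rewrite (big_nat_widen _ _ _ _ _ mN) (big_nat_widenl _ 0) //.
by rewrite big_mkord; apply: eq_bigl => h.
Qed.

(** One recursion for both kinds of sum: [gt] is [gtn] for [H] and [geq] for [Hstar]. *)
Fixpoint path_sum (R : realType) (gt : rel nat) (N : nat) (s : seq int)
    (b : nat) : R :=
  if s is e :: s' then
    \sum_(h < N | gt b h && (0 < h)%N) mzv_factor R e h * path_sum R gt N s' h
  else 1.

Lemma sum_tuple_path (R : realType) (gt : rel nat) N (s : seq int) b :
  \sum_(k : (size s).-tuple 'I_N |
          path gt b [seq val h | h <- k] && all (fun h => (0 < val h)%N) k)
    \prod_(i < size s) mzv_factor R s`_i (tnth k i) = path_sum R gt N s b.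
Proof.
elim: s b => [|e s IH] b /=.
  by rewrite (big_pred1 [tuple]) ?big_ord0 // => k; rewrite tuple0 /= eqxx.
rewrite (reindex (fun p : 'I_N * (size s).-tuple 'I_N => cons_tuple p.1 p.2));
  last first.
  exists (fun k => (thead k, behead_tuple k)) => [[h k] _|k _] /=.
    by congr pair; apply/val_inj.
  by rewrite [RHS]tuple_eta; apply/val_inj.
under [RHS]eq_bigr => h _ do rewrite -IH mulr_sumr.
rewrite pair_big_dep /=; apply: eq_big => [[h k]|[h k] _] /=.
  by rewrite -!andbA; congr andb; rewrite andbCA.
rewrite big_ord_recl /= tnth0; congr (_ * _); apply: eq_bigr => i _.
by rewrite tnthS.
Qed.

Lemma mzv_factor_pos (R : realType) x k : (0 < x)%N ->
  mzv_factor R x%:Z k = (k%:R ^+ x)^-1.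
Proof. by move=> x0; rewrite /mzv_factor gtr0_sgz // expr1n mul1r. Qed.

Lemma mzv_factor_neg (R : realType) x k : (0 < x)%N ->
  mzv_factor R (- x%:Z) k = (-1) ^+ k / k%:R ^+ x.
Proof.
by move=> x0; rewrite /mzv_factor sgzN gtr0_sgz // abszN mulrN1z.
Qed.

Fixpoint nested (R : realType) (u : seq nat) (b : nat) : R :=
  if u is x :: u' then psum (mulpow x (nested R u')) b else 1.

Lemma path_sum_nested (R : realType) N u b : all (leq 1) u -> (b <= N)%N ->
  path_sum R gtn N [seq x%:Z | x <- u] b = nested R u b.
Proof.
elim: u b => //= x u IH b /andP[x0 u0] bN.
rewrite /psum -(sum_ord_nat R _ _ N bN); apply: eq_bigr => h _.
rewrite mzv_factor_pos //.
rewrite IH //; last exact: ltnW.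
by rewrite /mulpow mulrC.
Qed.

Lemma Hstar_starsum (R : realType) s n : all (leq 1) s ->
  Hstar R [seq x%:Z | x <- s] n = starsum R s n.
Proof.
(* Indices in ['I_n.+1] are at most n, so the starting point n adds no constraint; in the strict
   case of [H] it has to be n + 1. *)
move=> s1; transitivity (path_sum R geq n.+1 [seq x%:Z | x <- s] n).
  rewrite /Hstar -sum_tuple_path; apply: eq_bigl => k; congr andb.
  by case: k => -[|h k] //= _; rewrite -ltnS ltn_ord.
suff /(_ n) -> : forall b, (b <= n)%N ->
  path_sum R geq n.+1 [seq x%:Z | x <- s] b = starsum R s b by [].
elim: s s1 => //= x s IH /andP[x0 s0] b bn.
rewrite /psum -(sum_ord_nat R _ b.+1 n.+1) //; apply: eq_bigr => h _.
rewrite mzv_factor_pos // IH //; last by rewrite -ltnS.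
by rewrite /mulpow mulrC.
Qed.

Lemma H_nu (R : realType) x u n : (0 < x)%N -> all (leq 1) u ->
  H R (nu (x :: u)) n
  = \sum_(1 <= k < n.+1) (-1) ^+ k * mulpow x (nested R u) k.
Proof.
move=> x0 u1; transitivity (path_sum R gtn n.+1 (nu (x :: u)) n.+1).
  rewrite /H -sum_tuple_path; apply: eq_bigl => k; congr andb.
  by case: k => -[|h k] //= _; rewrite ltn_ord.
rewrite /= -(sum_ord_nat R _ n.+1 n.+1) //; apply: eq_bigr => h _.
rewrite mzv_factor_neg // path_sum_nested //; last exact: ltnW.
by rewrite /mulpow -mulrA [_^-1 * _]mulrC.
Qed.

Lemma wordop_nested (R : realType) x u k :
  wordop (x :: u) (fun=> 1 : R) k = 2 ^+ size u * mulpow x (nested R u) k.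
Proof.
elim: u x k => [|y u IH] x k; first by rewrite mul1r.
rewrite [LHS]/(mulpow x (fun k => 2 * psum (wordop (y :: u) (fun=> 1)) k) k).
have -> : wordop (y :: u) (fun=> 1 : R) =
    fun k => 2 ^+ size u * mulpow y (nested R u) k.
  by apply/funext => l; rewrite IH.
by rewrite /psum -mulr_sumr /= exprS /mulpow /psum !mulrA.
Qed.

(** * Lists of blocks versus merges and substitutions *)

Definition block_seq {r : nat} (c : 'I_r -> nat) {I : {set 'I_r}}
  (p : choices I) : seq (seq nat) := [seq block c p t | t <- enum 'I_r].

Lemma block_in {r : nat} (c : 'I_r -> nat) (I : {set 'I_r}) (p : choices I) t :
  t \in I -> block c p t = [:: c t].
Proof. by move=> tI; rewrite /block insubF // tI. Qed.

Lemma block_notin {r : nat} (c : 'I_r -> nat) (I : {set 'I_r}) (p : choices I)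
    (u : {t | t \notin I}) :
  block c p (val u) = (p u).1.1 :: rcons (p u).1.2 (p u).2.
Proof. by rewrite /block valK; case: (p u) => -[]. Qed.

(** A merged block contributes 0 and a substituted one 1 + l(x): the total is the exponent of 2 in
    the theorem. *)
Lemma size_block {r : nat} (c : 'I_r -> nat) (I : {set 'I_r}) (p : choices I) :
  (\sum_t (size (block c p t)).-1)%N = (#|~: I| + total_length p)%N.
Proof.
rewrite (bigID (mem I)) /= big1 => [|t tI]; last by rewrite block_in.
rewrite add0n (big_sub [pred t | t \notin I] (fun t => (size (block c p t)).-1)).
under eq_bigr do rewrite block_notin /= size_rcons -add1n.
rewrite big_split sum_nat_const muln1 card_sig; congr (_ + _)%N.
by apply: eq_card => t; rewrite !inE.
Qed.

(** Substituted blocks have at least two entries, so block lengths determine I. *)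
Definition merged r (bs : seq (seq nat)) : {set 'I_r} :=
  [set t : 'I_r | size (nth [::] bs t) == 1%N].

Lemma nth_block_seq {r : nat} (c : 'I_r -> nat) (I : {set 'I_r})
  (p : choices I) (t : 'I_r) : nth [::] (block_seq c p) t = block c p t.
Proof. by rewrite (nth_map t) ?size_enum_ord // nth_ord_enum. Qed.

Lemma merged_block_seq {r : nat} (c : 'I_r -> nat) (I : {set 'I_r})
  (p : choices I) : merged r (block_seq c p) = I.
Proof.
apply/setP => t; rewrite inE nth_block_seq.
have [tI|tI] := boolP (t \in I); first by rewrite block_in.
by rewrite (block_notin c I p (exist _ t tI)) /= size_rcons.
Qed.

Lemma mem_block_listsP {r : nat} (c : 'I_r -> nat) bs :
  reflect (size bs = r /\ forall t : 'I_r, nth [::] bs t \in blocks (c t))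
    (bs \in block_lists [seq c t | t <- enum 'I_r]).
Proof.
rewrite mem_block_lists size_map size_enum_ord.
apply: (iffP andP) => -[].
  move=> /eqP sz /(all_nthP ([::], 0%N)) H; split=> // t.
  have := H t; rewrite size_zip size_map size_enum_ord sz minnn.
  rewrite nth_zip; last by rewrite size_map size_enum_ord.
  rewrite /= (nth_map t) ?size_enum_ord //.
  by rewrite nth_ord_enum; apply.
move=> sz H; rewrite sz eqxx; split=> //.
apply/(all_nthP ([::], 0%N)) => i.
rewrite size_zip size_map size_enum_ord sz minnn => ir.
rewrite nth_zip; last by rewrite size_map size_enum_ord.
rewrite /= (nth_map (Ordinal ir)) ?size_enum_ord //.
by have := H (Ordinal ir); rewrite (nth_ord_enum (Ordinal ir) (Ordinal ir)).
Qed.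

Lemma block_seq_bij {r : nat} (c : 'I_r -> nat) (I : {set 'I_r}) :
  (forall t, (2 <= c t)%N) ->
  set_bij (@admissible r c I)
    [set` [seq bs <- block_lists [seq c t | t <- enum 'I_r] | merged r bs == I]]
    (@block_seq r c I).
Proof.
move=> c2; split.
- move=> p pA /=; rewrite mem_filter merged_block_seq eqxx /=.
  apply/mem_block_listsP; split; first by rewrite size_map size_enum_ord.
  move=> t; rewrite nth_block_seq mem_blocks //.
  have [tI|tI] := boolP (t \in I).
    by rewrite block_in //= addn0 eqxx c2 ltnW ?c2.
  rewrite (block_notin c I p (exist _ t tI)).
  have := pA (exist _ t tI); case: (p _) => -[j x] i /= [cE i1 j2 x1].
  rewrite j2 ltnW //= all_rcons x1 i1 sumn_rcons -cE /=.
  by rewrite (addnC i j) -addnA (addnC i) eqxx.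
- move=> p q _ _ pq; apply/ffunP => u.
  have : block c p (val u) = block c q (val u) by rewrite -!nth_block_seq pq.
  rewrite !block_notin; case: (p u) (q u) => -[j x] i [[j' x'] i'] /= [-> /eqP].
  by rewrite eqseq_rcons => /andP[/eqP -> /eqP ->].
- move=> bs /=; rewrite mem_filter => /andP[/eqP mI /mem_block_listsP[sz bsc]].
  have sz2 u : u \notin I -> exists j x i, nth [::] bs u = j :: rcons x i.
    rewrite -mI inE; move: (bsc u); rewrite mem_blocks //.
    case: (nth _ _ _) => [|j y] //=; case/lastP: y => [|x i] //= _ _.
    by exists j, x, i.
  (* [g] undoes [j :: rcons x i]; by [sz2] it is applied only to words of length at least 2. *)
  pose g (b : seq nat) := (head 0%N b, belast (head 0%N (behead b)) (behead (behead b)),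
                           last 0%N b).
  pose p : choices I := [ffun u : {t | t \notin I} => g (nth [::] bs (val u))].
  have gE j x i : g (j :: rcons x i) = (j, x, i).
    rewrite /g /= last_rcons; congr (_, _, _).
    by case: x => [|y x] //=; rewrite belast_rcons.
  have pE t : block c p t = nth [::] bs t.
    have [tI|tI] := boolP (t \in I).
      rewrite block_in //; move: tI (bsc t); rewrite -mI inE mem_blocks //.
      by case: (nth _ _ _) => [|x [|]] //= _; rewrite addn0 => /andP[_ /andP[_ /eqP ->]].
    rewrite (block_notin c I p (exist _ t tI)).
    have [j [x [i bE]]] := sz2 _ tI.
    have -> : p (exist _ t tI) = (j, x, i) by rewrite ffunE bE gE.
    by rewrite bE.
  exists p => [u|].
    have := bsc (val u); rewrite mem_blocks // -pE block_notin.
    case: (p u) => -[j x] i /= /and3P[j2 /andP[_]].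
    rewrite all_rcons => /andP[i1 x1] /eqP <-; split => //.
    by rewrite sumn_rcons addnA [RHS]addnC addnA.
  apply: (@eq_from_nth _ [::]); first by rewrite size_map size_enum_ord sz.
  move=> i; rewrite size_map size_enum_ord => ir.
  by have := nth_block_seq c I p (Ordinal ir) => /= ->; rewrite pE.
Qed.

(** A list of blocks determines I through [merged], then the choice through [block_seq_bij]. *)
Lemma sum_admissible {V : nmodType} {r : nat} (c : 'I_r -> nat)
    (F : seq (seq nat) -> V) :
  (forall t, (2 <= c t)%N) ->
  \sum_(I : {set 'I_r}) \sum_(p \in @admissible r c I) F (block_seq c p)
  = \sum_(bs <- block_lists [seq c t | t <- enum 'I_r]) F bs.
Proof.
move=> c2; rewrite (partition_big (merged r) predT) //=; apply: eq_bigr => I _.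
rewrite -[RHS]big_filter [RHS]fsbig_seq; last exact/filter_uniq/uniq_block_lists.
by rewrite (reindex_fsbig _ _ _ _ (block_seq_bij c I c2)).
Qed.

Lemma kappa_interleave {r : nat} (a : 'I_r.+1 -> nat) (c : 'I_r -> nat)
    (I : {set 'I_r}) (p : choices I) :
  kappa a c p = interleave (a ord0)
    (zip (block_seq c p) [seq a (lift ord0 t) | t <- enum 'I_r]).
Proof.
rewrite /kappa /interleave zip_map; move: [:: _] (enum _) => u s.
by elim: s u => //= t s IH u; rewrite IH.
Qed.

Lemma size_glue u v : u != [::] -> v != [::] ->
  size (Defs.glue u v) = (size u + (size v).-1)%N.
Proof.
case: v => // y v; elim: u => // x [|z u] IH _ _ //.
by rewrite -[Defs.glue _ _]/(x :: Defs.glue (z :: u) (y :: v)) /= IH.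
Qed.

(** Each gluing fuses two entries into one, so the entries 2a do not lengthen the word. *)
Lemma size_interleave a0 l : all (fun x => x.1 != [::]) l ->
  size (interleave a0 l) = (\sum_(x <- l) (size x.1).-1).+1.
Proof.
rewrite /interleave => lP.
suff H u : u != [::] -> size (foldl
    (fun u x => Defs.glue (Defs.glue u x.1) [:: (2 * x.2)%N]) u l)
    = (size u + \sum_(x <- l) (size x.1).-1)%N by rewrite H.
elim: l lP u => [|x l IH] /= => [_|/andP[x0 lP]] u u0.
  by rewrite big_nil addn0.
have g0 : Defs.glue u x.1 != [::].
  by rewrite -size_eq0 size_glue // addn_eq0 size_eq0 (negPf u0).
rewrite IH // -?size_eq0 size_glue // ?addn0 ?size_eq0 //.
by rewrite size_glue // big_cons addnA.
Qed.

(** * Growth of nested sums and passage to the limit *)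

Section Limits.
Local Open Scope classical_set_scope.

Lemma sum_sqrt_div_le (R : realType) n :
  \sum_(1 <= k < n.+1) Num.sqrt k%:R / k%:R <= 2 * Num.sqrt n%:R :> R.
Proof.
elim: n => [|n IH]; first by rewrite big_geq // sqrtr0 mulr0.
rewrite big_nat_recr //=; apply: le_trans (lerD IH (lexx _)) _.
have p0 : 0 <= Num.sqrt n%:R :> R by exact: sqrtr_ge0.
have q0 : 0 < Num.sqrt n.+1%:R :> R by rewrite sqrtr_gt0 ltr0n.
have q2 : Num.sqrt n.+1%:R ^+ 2 = n.+1%:R :> R by rewrite sqr_sqrtr.
have pq : Num.sqrt n.+1%:R ^+ 2 = Num.sqrt n%:R ^+ 2 + 1 :> R.
  by rewrite !sqr_sqrtr // natr1.
rewrite -{2}q2; move: (Num.sqrt n%:R) (Num.sqrt n.+1%:R) p0 q0 pq {q2 IH}.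
move=> p q p0 q0 pq.
have -> : q / q ^+ 2 = q^-1 by field; lra.
(* Since q^2 = p^2 + 1, this product equals (q - p)^2. *)
have : 0 <= (2 * q - 2 * p - q^-1) * q.
  by rewrite !mulrBl mulVf ?gt_eqF //; nra.
by rewrite pmulr_lge0 //; lra.
Qed.

Lemma sum_sqrt_div2_le (R : realType) n :
  \sum_(1 <= k < n.+1) Num.sqrt k%:R / k%:R ^+ 2 <= 3 :> R.
Proof.
(* The sharper bound telescopes, with equality 1 = 3 - 2 at the first term; the shift by one keeps
   the square root nonzero. *)
suff : \sum_(1 <= k < n.+2) Num.sqrt k%:R / k%:R ^+ 2
    <= 3 - 2 / Num.sqrt n.+1%:R :> R.
  have q0 : 0 <= 2 / Num.sqrt n.+1%:R :> R by rewrite divr_ge0 // sqrtr_ge0.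
  have t0 : 0 <= Num.sqrt n.+1%:R / n.+1%:R ^+ 2 :> R.
    by rewrite divr_ge0 ?sqrtr_ge0 ?exprn_ge0.
  rewrite (big_nat_recr n.+1) //= => S_le.
  by rewrite -[leLHS]addr0 (le_trans (lerD (lexx _) t0)) ?(le_trans S_le) ?gerBl.
elim: n => [|n IH]; first by rewrite big_nat1 sqrtr1 expr1n; lra.
rewrite big_nat_recr //=; apply: le_trans (lerD IH (lexx _)) _.
have p0 : 0 < Num.sqrt n.+1%:R :> R by rewrite sqrtr_gt0 ltr0n.
have q0 : 0 < Num.sqrt n.+2%:R :> R by rewrite sqrtr_gt0 ltr0n.
have q2 : Num.sqrt n.+2%:R ^+ 2 = n.+2%:R :> R by rewrite sqr_sqrtr.
have pq : Num.sqrt n.+2%:R ^+ 2 = Num.sqrt n.+1%:R ^+ 2 + 1 :> R.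
  by rewrite !sqr_sqrtr // natr1.
rewrite -{2}q2; move: (Num.sqrt n.+1%:R) (Num.sqrt n.+2%:R) p0 q0 pq {q2 IH}.
move=> p q p0 q0 pq.
have pq' : p <= q by nra.
(* Clearing denominators and using q^2 - p^2 = 1 leaves 2 q^2 - p^2 - p q, nonnegative because p <=
   q. *)
have : 0 <= (2 / p - 2 / q - q / (q ^+ 2) ^+ 2) * (p * q ^+ 3 * (p + q)).
  have -> : (2 / p - 2 / q - q / (q ^+ 2) ^+ 2) * (p * q ^+ 3 * (p + q))
    = 2 * q ^+ 2 * (q ^+ 2 - p ^+ 2) - p * (p + q).
    by field; apply/andP; split; lra.
  rewrite pq; nra.
rewrite pmulr_lge0 ?mulr_gt0 ?exprn_gt0 ?addr_gt0 //; lra.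
Qed.

Lemma nested_ge0 (R : realType) u k : 0 <= nested R u k.
Proof.
elim: u k => //= x u IH k; apply: sumr_ge0 => i _.
by rewrite /mulpow divr_ge0 ?exprn_ge0.
Qed.

(** A square root dominates the logarithmic growth and is preserved, up to a factor 2, by a further
    summation against 1/l. *)
Lemma nested_le_sqrt (R : realType) u : all (leq 1) u ->
  exists2 C : R, 0 <= C & forall k, (0 < k)%N -> nested R u k <= C * Num.sqrt k%:R.
Proof.
elim: u => [_|x u IH /= /andP[x1 /IH[C C0 HC]]].
  exists 1 => // k k0; rewrite mul1r -[leLHS]sqrtr1 ler_sqrt ?ler1n //.
exists (C * 2) => [|k k0]; first by rewrite mulr_ge0.
case: k k0 => // k _; rewrite /psum.
apply: (@le_trans _ _ (\sum_(1 <= l < k.+1) C * (Num.sqrt l%:R / l%:R))).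
  rewrite !big_nat; apply: ler_sum => l /andP[l0 _].
  have l1 : 1 <= l%:R :> R by rewrite ler1n.
  have l2 : 0 < l%:R :> R by lra.
  rewrite /mulpow mulrA; apply: ler_pM; rewrite ?nested_ge0 ?HC //.
  by rewrite lef_pV2 ?posrE ?exprn_gt0 // ler_eXnr.
rewrite -mulr_sumr -mulrA ler_wpM2l //.
apply: le_trans (sum_sqrt_div_le _ _) _.
by rewrite ler_wpM2l // ler_sqrt ?ler_nat.
Qed.

Lemma sum_nested_bounded (R : realType) x u : (2 <= x)%N -> all (leq 1) u ->
  exists M : R, forall n, \sum_(1 <= k < n.+1) mulpow x (nested R u) k <= M.
Proof.
move=> x2 /(nested_le_sqrt R)[C C0 HC]; exists (C * 3) => n.
apply: le_trans (ler_wpM2l C0 (sum_sqrt_div2_le R n)).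
rewrite mulr_sumr !big_nat; apply: ler_sum => k /andP[k0 _].
have k1 : 1 <= k%:R :> R by rewrite ler1n.
have k2 : 0 < k%:R :> R by lra.
rewrite /mulpow mulrA; apply: ler_pM; rewrite ?nested_ge0 ?HC //.
by rewrite lef_pV2 ?posrE ?exprn_gt0 // ler_weXn2l.
Qed.

Lemma cvgn_sum_nneg {R : realType} (g : nat -> R) (M : R) :
  (forall k, 0 <= g k) ->
  (forall n, \sum_(1 <= k < n.+1) g k <= M) ->
  cvgn (fun n => \sum_(1 <= k < n.+1) g k).
Proof.
move=> g_ge0 g_bound.
apply: nondecreasing_is_cvgn.
  by apply/nondecreasing_seqP => n; rewrite [leRHS]big_nat_recr //= lerDl.
by exists M => _ [n _ <-].
Qed.

Lemma cvgn_sum_alt {R : realType} (g : nat -> R) (M : R) :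
  (forall k, 0 <= g k) ->
  (forall n, \sum_(1 <= k < n.+1) g k <= M) ->
  cvgn (fun n => \sum_(1 <= k < n.+1) (-1) ^+ k * g k).
Proof.
move=> g_ge0 g_bound.
have E (h : nat -> R) n : series (fun k => h k.+1) n = \sum_(1 <= k < n.+1) h k.
  by rewrite /series /= big_add1.
rewrite (_ : (fun n => _) = series (fun k => (-1) ^+ k.+1 * g k.+1)).
  apply: normed_cvg; rewrite /normed_series_of.
  rewrite (_ : [series _]_n = fun n => \sum_(1 <= k < n.+1) g k).
    exact: (cvgn_sum_nneg g M).
  apply/funext => n; rewrite -E; apply: eq_bigr => k _.
  by rewrite /= normrM normrX normrN1 expr1n mul1r ger0_norm.
by apply/funext => n; rewrite (E (fun k => (-1) ^+ k * g k)).
Qed.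

(** Split at N: up to N the defect 1 - w_n(k) is at most N^2 / n, beyond N it is at most 1. *)
Lemma wsum_diff_le {R : realType} (g : nat -> R) (M : R) N n :
  (forall k, 0 <= g k) ->
  (forall n, \sum_(1 <= k < n.+1) g k <= M) ->
  (N < n)%N ->
  `|\sum_(1 <= k < n.+1) (-1) ^+ k * g k - wsum n g|
  <= N%:R ^+ 2 * M / n%:R
     + (\sum_(1 <= k < n.+1) g k - \sum_(1 <= k < N.+1) g k).
Proof.
move=> g_ge0 g_bound.
case: n => // n; rewrite ltnS => Nn; rewrite -sumrB.
apply: le_trans (ler_norm_sum _ _ _) _.
have -> : \sum_(1 <= k < n.+2) `|(-1) ^+ k * g k - bweight R n.+1 k * (-1) ^+ k * g k|
   = \sum_(1 <= k < n.+2) (1 - bweight R n.+1 k) * g k.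
  apply: eq_bigr => k _.
  have -> : (-1) ^+ k * g k - bweight R n.+1 k * (-1) ^+ k * g k
    = (-1) ^+ k * ((1 - bweight R n.+1 k) * g k) by ring.
  rewrite normrM normrX normrN1 expr1n mul1r ger0_norm //.
  by rewrite mulr_ge0 // subr_ge0 (bweight_bounds R n k).1.
rewrite !(@big_cat_nat _ _ _ N.+1 1 n.+2) //= ?ltnS ?leqW //.
rewrite [X in _ + (X - _)]addrC addrK; apply: lerD.
  apply: (@le_trans _ _ (\sum_(1 <= k < N.+1) N%:R ^+ 2 / n.+1%:R * g k)).
    rewrite !big_nat; apply: ler_sum => k /andP[_ kN]; apply: ler_wpM2r => //.
    apply: le_trans (bweight_bounds R n k).2 _; rewrite ler_wpM2r ?invr_ge0 //.
    by rewrite lerXn2r ?nnegrE // ler_nat.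
  by rewrite -mulr_sumr [leRHS]mulrAC ler_wpM2l // divr_ge0 // exprn_ge0.
apply: ler_sum => k _; rewrite -[leRHS]mul1r ler_wpM2r //.
by have := bweight_ge0 R n.+1 k; lra.
Qed.

Lemma cvg_wsum {R : realType} (g : nat -> R) (M : R) :
  (forall k, 0 <= g k) ->
  (forall n, \sum_(1 <= k < n.+1) g k <= M) ->
  wsum n g @[n --> \oo] --> limn (fun n => \sum_(1 <= k < n.+1) (-1) ^+ k * g k).
Proof.
move=> g_ge0 g_bound.
set h := fun n => \sum_(1 <= k < n.+1) (-1) ^+ k * g k.
have hl : h n @[n --> \oo] --> limn h := cvgn_sum_alt g M g_ge0 g_bound.
have sl := cvgn_sum_nneg g M g_ge0 g_bound; set S := fun n => _ in sl.
suff d0 : h n - wsum n g @[n --> \oo] --> (0 : R).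
  rewrite -[limn h]subr0 (_ : (fun n => _) = fun n => h n - (h n - wsum n g)).
    exact: cvgB.
  by apply/funext => n; rewrite subKr.
have M0 : 0 <= M by apply: le_trans (g_bound 0); rewrite big_geq.
apply/cvgrPdist_lt => e e0.
have S_nd : nondecreasing_seq S.
  by apply/nondecreasing_seqP => n; rewrite /S [leRHS]big_nat_recr //= lerDl.
have Sl n : S n <= limn S by exact: nondecreasing_cvgn_le.
have e2 : 0 < e / 2 by lra.
(* N is fixed first, making the tail less than e/2; n is then taken beyond both N and N^2 M /
   (e/2). *)
move/cvgrPdist_lt : sl => /(_ _ e2)[N _ HN].
near=> n; rewrite sub0r normrN.
have nN : (N < n)%N by near: n; exact: nbhs_infty_gt.
have : N%:R ^+ 2 * M / (e / 2) < n%:R by near: n; exact: nbhs_infty_gtr.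
have n0 : 0 < n%:R :> R by rewrite ltr0n (leq_ltn_trans _ nN).
rewrite ltr_pdivrMr // [ltRHS]mulrC -ltr_pdivrMr // => Hn.
apply: le_lt_trans (wsum_diff_le g M N n g_ge0 g_bound nN) _.
have := HN N (leqnn N); rewrite ger0_norm ?subr_ge0 //= => HS.
rewrite [ltRHS]splitr; apply: ltrD => //.
by apply: le_lt_trans HS; apply: lerB => //; exact: Sl.
Unshelve. all: by end_near. Qed.

Lemma cvg_wsum_wordop (R : realType) x u : (2 <= x)%N -> all (leq 1) u ->
  wsum n (wordop (x :: u) (fun=> 1 : R)) @[n --> \oo] -->
  2 ^+ size u * zeta R (nu (x :: u)).
Proof.
move=> x2 u1; have [M HM] := sum_nested_bounded R x u x2 u1.
rewrite (_ : (fun n => _) = fun n =>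
    2 ^+ size u * wsum n (mulpow x (nested R u))); last first.
  apply/funext => n; rewrite /wsum mulr_sumr; apply: eq_bigr => k _.
  by rewrite wordop_nested mulrCA.
apply: cvgMr; rewrite /zeta.
rewrite (_ : H R _ = fun n => \sum_(1 <= k < n.+1)
    (-1) ^+ k * mulpow x (nested R u) k).
  apply: (cvg_wsum _ M) => // k.
  by rewrite /mulpow divr_ge0 ?nested_ge0 ?exprn_ge0.
by apply/funext => n; rewrite H_nu // ltnW.
Qed.

End Limits.

(** * Absolute convergence for the words that occur *)

Definition convergent_word (u : seq nat) : bool :=
  (2 <= head 0 u)%N && all (leq 1) (behead u).

(** The head of v is unconstrained, since v may be [[:: 0]] (an entry 2a with a = 0); it is added to
    a positive entry. *)
Lemma all_pos_glue u v : u != [::] -> all (leq 1) u -> all (leq 1) (behead v) ->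
  all (leq 1) (Defs.glue u v).
Proof.
elim: u => // x [|y u] IH _ /andP[x1 u1] v1.
  clear IH; case: v v1 => [|y v] /= v1; first by rewrite x1.
  by rewrite v1 (leq_trans x1) ?leq_addr.
by rewrite -[Defs.glue _ _]/(x :: Defs.glue (y :: u) v) /= x1 IH.
Qed.

Lemma convergent_glue u v : convergent_word u -> all (leq 1) (behead v) ->
  convergent_word (Defs.glue u v).
Proof.
case: u => // x [|y u] /andP[x2 u1] v1; rewrite /convergent_word.
  case: v v1 => [|y v] /= v1; first by rewrite x2.
  by rewrite v1 (leq_trans x2) ?leq_addr.
rewrite -[Defs.glue _ _]/(x :: Defs.glue (y :: u) v).
by apply/andP; split; [exact: x2 | apply: all_pos_glue].
Qed.

Lemma convergent_glue1 x v : convergent_word v -> convergent_word (Defs.glue [:: x] v).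
Proof.
case: v => // y v /andP[/= y2 v1]; rewrite /convergent_word /= v1.
by rewrite (leq_trans y2) ?leq_addl.
Qed.

(** If there is a block, its head is at least 2 even when a0 = 0; otherwise the word is
    [[:: 2 * a0]] with a0 > 0. *)
Lemma convergent_interleave a0 l :
  all (fun x => convergent_word x.1) l -> (0 < a0 + size l)%N ->
  convergent_word (interleave a0 l).
Proof.
case: l => [_|x l /= /andP[xc lc] _].
  rewrite addn0 => a0_gt0; rewrite /convergent_word /= andbT mul2n -addnn.
  exact: (leq_add a0_gt0 a0_gt0).
have : convergent_word (Defs.glue (Defs.glue [:: (2 * a0)%N] x.1) [:: (2 * x.2)%N]).
  by apply: convergent_glue => //; exact: convergent_glue1.
rewrite /interleave /=; elim: l lc (Defs.glue _ _) => //= y l IH /andP[yc lc] u uc.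
apply: IH => //; apply: convergent_glue => //.
by apply: convergent_glue => //; case/andP: yc.
Qed.

Lemma string_s_zip {r : nat} (a : 'I_r.+1 -> nat) (c : 'I_r -> nat) :
  string_s a c = nseq (a ord0) 2%N ++ flatten [seq x.1 :: nseq x.2 2%N |
    x <- zip [seq c t | t <- enum 'I_r] [seq a (lift ord0 t) | t <- enum 'I_r]].
Proof. by rewrite zip_map -map_comp. Qed.

Lemma string_s_ge2 {r : nat} (a : 'I_r.+1 -> nat) (c : 'I_r -> nat) :
  (forall t, (2 <= c t)%N) -> all (leq 2) (string_s a c).
Proof.
move=> c2; rewrite all_cat all_nseq orbT /=; apply/allP => x /flatten_mapP[t _].
by rewrite inE => /orP[/eqP ->|/nseqP[-> _]].
Qed.

Lemma size_kappa {r : nat} (a : 'I_r.+1 -> nat) (c : 'I_r -> nat)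
    (I : {set 'I_r}) (p : choices I) :
  size (kappa a c p) = (#|~: I| + total_length p).+1.
Proof.
rewrite kappa_interleave size_interleave; last first.
  rewrite zip_map; apply/allP => _ /mapP[t _ ->] /=.
  have [tI|tI] := boolP (t \in I); first by rewrite block_in.
  by rewrite (block_notin c I p (exist _ t tI)).
by rewrite zip_map big_map big_enum /= size_block.
Qed.

Theorem theorem4p1 (R : realType) (r : nat) (a : 'I_r.+1 -> nat)
    (c : 'I_r -> nat) (c_ge2 : forall t, (2 <= c t)%N)
    (s_nonempty : string_s a c <> [::]) :
  zetastar R [seq x%:Z | x <- string_s a c] =
  - 2 * \sum_(I : {set 'I_r}) \sum_(p \in @admissible r c I)
          2 ^+ (#|~: I| + total_length p) * zeta R (nu (kappa a c p)).
Proof.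
pose cs := [seq c t | t <- enum 'I_r].
pose l := [seq a (lift ord0 t) | t <- enum 'I_r].
pose word bs := interleave (a ord0) (zip bs l).
(* By [size_kappa] the power of 2 depends only on the length of the word, so the summand is a
   function of the list of blocks. *)
pose F bs := 2 ^+ (size (word bs)).-1 * zeta R (nu (word bs)).
have -> : \sum_(I : {set 'I_r}) \sum_(p \in @admissible r c I)
      2 ^+ (#|~: I| + total_length p) * zeta R (nu (kappa a c p))
    = \sum_(bs <- block_lists cs) F bs.
  rewrite -(sum_admissible c F c_ge2); apply: eq_bigr => I _.
  apply: eq_fsbigr => p _.
  by rewrite /F /word -kappa_interleave size_kappa.
apply/cvg_lim => //.
have -> : Hstar R [seq x%:Z | x <- string_s a c] =
    starsum R (string_s a c).
  apply/funext => n; apply: Hstar_starsum.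
  by apply: sub_all (string_s_ge2 a c c_ge2) => x; exact: ltnW.
(* The finite identity holds for n > 0, hence eventually, which suffices for the limit. *)
suff : (- 2 * wsum n (starfun R (string_s a c)) @[n --> \oo] -->
    - 2 * \sum_(bs <- block_lists cs) F bs)%classic.
  apply: cvg_trans; apply: near_eq_cvg; near=> n.
  rewrite starsum_wsum ?string_s_ge2 //; near: n; exact: nbhs_infty_gt.
apply: cvgMr.
have -> : (fun n => wsum n (starfun R (string_s a c))) = fun n =>
    \sum_(bs <- block_lists cs) wsum n (wordop (word bs) (fun=> 1)).
  apply/funext => n; rewrite /wsum exchange_big; apply: eq_bigr => k _.
  rewrite -mulr_sumr string_s_zip sum_wordop_interleave //.
  by rewrite !size_map.
(* Membership in [block_lists] is kept in both sums, since termwise convergence depends on it. *)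
rewrite big_seq; under eq_fun do rewrite big_seq.
apply: cvg_big => [|bs /mem_block_listsP[sz bsP]]; first exact: add_continuous.
have : convergent_word (word bs).
  apply: convergent_interleave.
    rewrite -(all_map fst convergent_word) -/(unzip1 _) unzip1_zip; last first.
      by rewrite size_map size_enum_ord sz.
    apply/(all_nthP [::]) => i; rewrite sz => ir.
    have := bsP (Ordinal ir); rewrite mem_blocks // => /and3P[].
    by rewrite /convergent_word; case: (nth _ _ _) => //= x u -> /andP[_ ->].
  (* If a_1 = 0 and r = 0, the string s would be empty. *)
  rewrite size_zip size_map size_enum_ord sz minnn lt0n; apply/eqP => /eqP.
  rewrite addn_eq0 => /andP[/eqP a0 /eqP r0]; apply: s_nonempty.
  by rewrite /string_s a0 /= [enum _]size0nil // size_enum_ord.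
rewrite /F; case: (word bs) => // x u /andP[x2 u1].
exact: cvg_wsum_wordop.
Unshelve. all: by end_near. Qed.
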